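(* Let $P$ be the probability distribution on $\mathbb R$ with probability density function $f(x)=\frac25$ for $0\le x\le\frac12$, $f(x)=\frac85$ for $\frac12<x\le1$, and $f(x)=0$ otherwise. Then $\{\frac{11}{32},\frac{25}{32}\}$ is the unique optimal set of two-means for $P$, with quantization error $V_2(P)=\frac{317}{15360}$.
   Context: For a Borel probability measure $P$ on $\mathbb R$ and $n\ge1$, the $n$th quantization error is $V_n(P)=\inf\{\int \min_{a\in\alpha}(x-a)^2\,dP(x):\alpha\subset\mathbb R,\ \mathrm{card}(\alpha)\le n\}$. A set $\alpha$ with $\mathrm{card}(\alpha)\le n$ attaining the infimum is called an optimal set of $n$-means; for absolutely continuous $P$ it has exactly $n$ elements. *)

(* Defs.v *)
From HB Require Import structures.
From mathcomp Require Import all_boot all_order all_algebra finmap.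
From mathcomp Require Import all_classical all_reals all_analysis.
Set Implicit Arguments.
Unset Strict Implicit.
Unset Printing Implicit Defensive.
Import Order.TTheory GRing.Theory Num.Theory.
Import numFieldNormedType.Exports.
Local Open Scope classical_set_scope.
Local Open Scope ring_scope.

(* The minimum is taken in the extended reals with neutral element +oo, so it
   is the ordinary minimum for nonempty alpha, and the empty set has infinite
   distortion (hence never competes in the infimum below). *)
Definition distortion (R : realType) (P : probability (measurableTypeR R) R)
    (alpha : {fset R}) : \bar R :=
  (\int[P]_x \big[Order.min/+oo]_(a <- alpha) ((x - a) ^+ 2)%:E)%E.

Definition quantization_error (R : realType)
    (P : probability (measurableTypeR R) R) (n : nat) : \bar R :=
  ereal_inf [set distortion P alpha | alpha in
               [set alpha : {fset R} | (#|` alpha| <= n)%N]].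

Definition optimal_set (R : realType) (P : probability (measurableTypeR R) R)
    (n : nat) (alpha : {fset R}) : Prop :=
  (#|` alpha| <= n)%N /\ distortion P alpha = quantization_error P n.

Definition has_density (R : realType) (P : probability (measurableTypeR R) R)
    (f : R -> R) : Prop :=
  forall A : set (measurableTypeR R), measurable A ->
    P A = (\int[lebesgue_measure]_(x in A) (f x)%:E)%E.

Definition two_step_pdf (R : realType) (x : R) : R :=
  if 0 <= x <= 1 / 2 then 2 / 5
  else if 1 / 2 < x <= 1 then 8 / 5
  else 0.

(* Main.v *)
(* For a <= b the distortion of {a, b} splits at the midpoint m of a and b,
   clamped to [0, 1], into integrals of (x - a)^2 over [0, m] and of (x - b)^2
   over [m, 1].  Freeing the cut point from the constraint m = (a + b) / 2 and
   completing the squares in a and b leaves 317/15360 plus a nonnegative function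
   of the cut alone; its only zero on [0, 1] is the cut 9/16, and the squares
   then force a = 11/32, b = 25/32. *)

Require Import Defs.
From HB Require Import structures.
From mathcomp Require Import all_boot all_order all_algebra finmap.
From mathcomp Require Import ring lra.
From mathcomp Require Import all_classical all_reals all_analysis measurable_realfun.
Import Order.TTheory GRing.Theory Num.Theory.
Import numFieldNormedType.Exports.
Set Implicit Arguments.
Unset Strict Implicit.
Local Open Scope classical_set_scope.
Local Open Scope fset_scope.
Local Open Scope ring_scope.

Lemma integral_constant_density (R : realType)
    (P : probability (measurableTypeR R) R) (f : R -> R) (D : set R)
    (k : {nonneg R}) (g : R -> \bar R) :
  has_density P f -> measurable D -> (forall x, D x -> f x = k%:num) ->
  measurable_fun D g -> (forall x, D x -> (0 <= g x)%E) ->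
  (\int[P]_(x in D) g x = k%:num%:E * \int[lebesgue_measure]_(x in D) g x)%E.
Proof.
move=> hP mD fD mg g0.
(* On measurable subsets of [D] the measure [P] coincides with [k] times Lebesgue measure. *)
rewrite -ge0_integral_mscale//; apply: eq_measure_integral => A mA AD.
rewrite [LHS]hP// (eq_integral (cst k%:num%:E)) ?integral_cst//.
by move=> x; rewrite inE => /AD /fD ->.
Qed.

(** The density is constant on each of [[0, 1/2]], []1/2, 1]] and their complement, where it is [0].
    The second interval may be closed because a point is Lebesgue-null. *)
Lemma integral_two_step (R : realType) (P : probability (measurableTypeR R) R)
    (g : R -> \bar R) :
  has_density P (@two_step_pdf R) -> measurable_fun setT g ->
  (forall x, (0 <= g x)%E) ->
  (\int[P]_x g x =
    (2 / 5)%:E * \int[lebesgue_measure]_(x in `[0%R, (1 / 2)%R]) g x +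
    (8 / 5)%:E * \int[lebesgue_measure]_(x in `[(1 / 2)%R, 1%R]) g x)%E.
Proof.
move=> hP mg g0.
have p25 : 0 <= (2 / 5 : R) by lra.
have p85 : 0 <= (8 / 5 : R) by lra.
set A : set R := `[0%R, (1 / 2)%R]%classic.
set B : set R := `](1 / 2)%R, 1%R]%classic.
have mA : measurable A by exact: measurable_itv.
have mB : measurable B by exact: measurable_itv.
have mAB : measurable (A `|` B) by exact: measurableU.
have mgD D : measurable_fun D g by exact: measurable_funTS.
have AB : [disjoint A & B]%classic.
  apply/disj_setPS => x [] /=; rewrite /A /B /= !in_itv/=; lra.
rewrite -(setUv (A `|` B)%classic) ge0_integral_setU//; last 3 first.
- exact: measurableC.
- exact: mgD.
- by apply/disj_setPCl.
rewrite ge0_integral_setU//; last exact: mgD.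
rewrite (integral_constant_density hP mA (k := NngNum p25))//; last first.
  by move=> x; rewrite /A /= in_itv/= /two_step_pdf => ->.
rewrite (integral_constant_density hP mB (k := NngNum p85))//; last first.
  move=> x; rewrite /B /= in_itv/= /two_step_pdf => xB; rewrite xB ifF//.
  by apply/negP => ?; lra.
rewrite (integral_constant_density hP (measurableC mAB) (k := 0%:nng))//; last first.
  move=> x; rewrite /A /B /= !in_itv/= /two_step_pdf.
  by move=> /not_orP[/negP/negPf -> /negP/negPf ->].
rewrite /= mul0e adde0; congr (_ + _ * _)%E.
by rewrite integral_itv_obnd_cbnd//; exact: mgD.
Qed.

Definition sqr_int (R : realType) (e c d : R) : R :=
  ((d - e) ^+ 3 - (c - e) ^+ 3) / 3.

Lemma integral_sqrB (R : realType) (e c d : R) : c <= d ->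
  (\int[lebesgue_measure]_(x in `[c, d]) ((x - e) ^+ 2)%:E = (sqr_int e c d)%:E)%E.
Proof.
(* The fundamental theorem of calculus is applied on a nondegenerate interval, so [c = d] is treated
   apart. *)
rewrite le_eqVlt => /predU1P[->|cd].
  by rewrite set_itv1 integral_set1 /sqr_int subrr mul0r.
pose F : R -> R := fun x => (x - e) ^+ 3 / 3.
have dF (x : R) : is_derive x (1 : R) F ((x - e) ^+ 2).
  rewrite /F; apply: is_derive_eq.
  by rewrite /GRing.scale/=; field.
have cF : continuous F by move=> x; apply/differentiable_continuous/derivable1_diffP.
rewrite (@continuous_FTC2 _ _ F)//.
- by rewrite /F -EFinB /sqr_int; congr EFin; ring.
- apply: continuous_subspaceT => x.
  by apply/differentiable_continuous/derivable1_diffP; exact: ex_derive.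
- split.
  + by [].
  + by apply: cvg_at_right_filter; exact: cF.
  + by apply: cvg_at_left_filter; exact: cF.
- by move=> x _; rewrite derive1E; apply: derive_val.
Qed.

Lemma measurable_sqrB (R : realType) (e : R) :
  measurable_fun [set: measurableTypeR R] (fun x : R => ((x - e) ^+ 2)%:E).
Proof.
by apply/measurable_EFinP; apply: measurable_funX; apply: measurable_funB.
Qed.

(** Since [(x - b)^2 - (x - a)^2 = (b - a)(a + b - 2x)], the point [a] is the nearer one to the left
    of the midpoint and [b] to its right. The last two hypotheses become vacuous at [t = c] and
    [t = d] respectively, so [t] may be the midpoint clamped to [[c, d]]. *)
Lemma integral_min_sqrB (R : realType) (a b c t d : R) :
  a <= b -> c <= t -> t <= d ->
  (forall x, c <= x < t -> x <= (a + b) / 2) ->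
  (forall x, t < x <= d -> (a + b) / 2 <= x) ->
  (\int[lebesgue_measure]_(x in `[c, d])
     Order.min ((x - a) ^+ 2)%:E ((x - b) ^+ 2)%:E =
   (sqr_int a c t + sqr_int b t d)%:E)%E.
Proof.
move=> ab ct td xt tx.
have mg D : measurable_fun D (fun x : measurableTypeR R =>
    Order.min ((x - a) ^+ 2)%:E ((x - b) ^+ 2)%:E).
  by apply: measurable_funTS; apply: measurable_mine; exact: measurable_sqrB.
rewrite (@itv_bndbnd_setU _ _ _ (BLeft t))//.
rewrite ge0_integral_setU//; last 2 first.
- by move=> x _; rewrite /= le_min !lee_fin !sqr_ge0.
- apply/disj_setPS => x [] /=; rewrite !in_itv/=; lra.
have mf e D : measurable_fun D (fun x : R => ((x - e) ^+ 2)%:E).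
  by apply: measurable_funTS; exact: measurable_sqrB.
(* The null point [t] is removed from both pieces, leaving the strict inequalities that the
   hypotheses on [t] require. *)
rewrite EFinD -!integral_sqrB// -integral_itv_bndo_bndc//.
rewrite -!(@integral_itv_obnd_cbnd _ t (BRight d))//; last exact: mg.
congr (_ + _)%E; apply: eq_integral => x; rewrite inE/= in_itv/= => xI.
- apply/min_idPl; rewrite lee_fin; have := xt _ xI; nra.
- apply/min_idPr; rewrite lee_fin; have := tx _ xI; nra.
Qed.

(* The cut is s when s <= 1/2 = t, and t when s = 1/2 <= t. *)
Definition two_piece_distortion (R : realType) (a b s t : R) : R :=
  2 / 5 * (sqr_int a 0 s + sqr_int b s (1 / 2)) +
  8 / 5 * (sqr_int a (1 / 2) t + sqr_int b t 1).

(** Each square is weighted by the mass of [P] on its side of the cut [s] and centred at the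
    conditional mean there. The remainder is positive throughout, so no optimal cut lies in
    [[0, 1/2]]. *)
Lemma two_piece_distortion_left (R : realType) (a b s : R) : 0 <= s <= 1 / 2 ->
  317 / 15360 < two_piece_distortion a b s (1 / 2).
Proof.
move=> /andP[s0 s1]; rewrite -subr_gt0.
have k0 : 0 < 5 - 2 * s by lra.
(* The numerator of the last summand is split along its tangent line at s = 1/2. *)
rewrite (_ : _ - _ = 2 * s / 5 * (a - s / 2) ^+ 2
  + (5 - 2 * s) / 5 * (b - (13 - 4 * s ^+ 2) / (4 * (5 - 2 * s))) ^+ 2
  + (1 / 1280 + (1 / 2 - s) / 2560 + (s - 1 / 2) ^+ 2 * (4 / 5 - s / 2))
    / (5 - 2 * s)); last first.
  by rewrite /two_piece_distortion /sqr_int; field; rewrite gt_eqF.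
have c0 : 0 < 1 / 1280 + (1 / 2 - s) / 2560 by lra.
have d0 : 0 <= 4 / 5 - s / 2 by lra.
have e0 : 0 <= 2 * s / 5 by lra.
have f0 : 0 <= (5 - 2 * s) / 5 by lra.
apply: (ltr_wpDl (addr_ge0 (mulr_ge0 e0 (sqr_ge0 _)) (mulr_ge0 f0 (sqr_ge0 _)))).
exact: (divr_gt0 (ltr_wpDr (mulr_ge0 (sqr_ge0 _) d0) c0) k0).
Qed.

(** The same completion of squares, with the masses and conditional means on the two sides of [t];
    the remainder has a double zero at [9/16]. *)
Lemma two_piece_distortion_rightE (R : realType) (a b t : R) : 1 / 2 <= t ->
  two_piece_distortion a b (1 / 2) t = 317 / 15360
  + (8 * t - 3) / 5 * (a - (16 * t ^+ 2 - 3) / (4 * (8 * t - 3))) ^+ 2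
  + 8 * (1 - t) / 5 * (b - (1 + t) / 2) ^+ 2
  + (t - 9 / 16) ^+ 2 * ((2 * t - 19 / 20) / (8 * t - 3)).
Proof.
move=> t1; rewrite /two_piece_distortion /sqr_int; field; rewrite gt_eqF//; lra.
Qed.

Lemma two_piece_distortion_right (R : realType) (a b t : R) : 1 / 2 <= t <= 1 ->
  317 / 15360 <= two_piece_distortion a b (1 / 2) t ?= iff
    [&& t == 9 / 16, a == 11 / 32 & b == 25 / 32].
Proof.
move=> /andP[t1 t2].
have a0 : 0 < (8 * t - 3) / 5 by lra.
have b0 : 0 <= 8 * (1 - t) / 5 by lra.
have q0 : 0 < (2 * t - 19 / 20) / (8 * t - 3) by rewrite divr_gt0//; lra.
have opt : two_piece_distortion (11 / 32) (25 / 32) (1 / 2) (9 / 16) = 317 / 15360 :> R.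
  by rewrite /two_piece_distortion /sqr_int; field.
rewrite two_piece_distortion_rightE//.
set u := _ * (a - _) ^+ 2; set v := _ * (b - _) ^+ 2; set w := _ ^+ 2 * _.
have u0 : 0 <= u by rewrite mulr_ge0 ?sqr_ge0// ltW.
have v0 : 0 <= v by rewrite mulr_ge0 ?sqr_ge0.
have w0 : 0 <= w by rewrite mulr_ge0 ?sqr_ge0// ltW.
have wE : w = 0 -> t = 9 / 16.
  by move/eqP; rewrite mulf_eq0 sqrf_eq0 (gt_eqF q0) orbF subr_eq0 => /eqP.
have uE : t = 9 / 16 -> u = 0 -> a = 11 / 32.
  move=> tE /eqP; rewrite mulf_eq0 (gt_eqF a0) sqrf_eq0 subr_eq0 => /eqP ->.
  by rewrite tE; field.
(* The weight [8 * (1 - t) / 5] vanishes at [t = 1], so [v = 0] determines [b] only once [t] is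
   known. *)
have vE : t = 9 / 16 -> v = 0 -> b = 25 / 32.
  move=> tE /eqP; rewrite mulf_eq0 sqrf_eq0 subr_eq0 tE => /orP[/eqP|/eqP ->].
    by move=> h; exfalso; move: h; clear; lra.
  by field.
split; first by rewrite -!addrA lerDl !addr_ge0.
apply/eqP/and3P => [D|[/eqP tE /eqP aE /eqP bE]]; last first.
  by rewrite /u /v /w -two_piece_distortion_rightE// tE aE bE opt.
have : u + v + w == 0 by rewrite -(inj_eq (addrI (317 / 15360))) addr0 !addrA -D.
rewrite !paddr_eq0 ?addr_ge0// => /andP[/andP[/eqP u_eq0 /eqP v_eq0] /eqP w_eq0].
by have tE := wE w_eq0; rewrite tE uE// vE// !eqxx.
Qed.

(** The midpoint is clamped to each half of [[0, 1]] separately, so at least one of the two cuts is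
    [1 / 2], as the bounds above require. *)
Definition distortion2 (R : realType) (a b : R) : R :=
  two_piece_distortion a b (Num.max 0 (Num.min (1 / 2) ((a + b) / 2)))
                           (Num.max (1 / 2) (Num.min 1 ((a + b) / 2))).

Lemma integral_min_two_step (R : realType) (P : probability (measurableTypeR R) R)
    (a b : R) :
  has_density P (@two_step_pdf R) -> a <= b ->
  (\int[P]_x Order.min ((x - a) ^+ 2)%:E ((x - b) ^+ 2)%:E =
    (distortion2 a b)%:E)%E.
Proof.
move=> hP ab; rewrite integral_two_step//; first last.
- by move=> x; rewrite /= le_min !lee_fin !sqr_ge0.
- by apply: measurable_mine; exact: measurable_sqrB.
set m := (a + b) / 2; set s := Num.max 0 (Num.min (1 / 2) m).
set t := Num.max (1 / 2) (Num.min 1 m).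
rewrite (@integral_min_sqrB _ a b 0 s) ?(@integral_min_sqrB _ a b (1 / 2) t)//.
- by rewrite le_max lexx.
- by rewrite ge_max ge_min lexx andbT; lra.
- by move=> x; rewrite -/m /t lt_max lt_min; lra.
- by move=> x; rewrite -/m /t gt_max gt_min; lra.
- by rewrite le_max lexx.
- by rewrite ge_max ge_min lexx andbT; lra.
- by move=> x; rewrite -/m /s lt_max lt_min; lra.
- by move=> x; rewrite -/m /s gt_max gt_min; lra.
Qed.

Lemma distortion2_leif (R : realType) (a b : R) :
  317 / 15360 <= distortion2 a b ?= iff (a == 11 / 32) && (b == 25 / 32).
Proof.
rewrite /distortion2; set m := (a + b) / 2.
have [m1|m1] := leP m (1 / 2).
  have -> : Num.min 1 m = m by apply/min_idPr; lra.
  rewrite (max_idPl m1).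
  have lt := @two_piece_distortion_left R a b (Num.max 0 m).
  apply/leifP; rewrite ifF ?lt//; first by rewrite le_max lexx ge_max m1 andbT; lra.
  by apply/negP => /andP[/eqP aE /eqP bE]; move: m1; rewrite /m aE bE; lra.
rewrite (_ : Num.max 0 (1 / 2) = 1 / 2); last by apply/max_idPr; lra.
rewrite (_ : Num.max (1 / 2) _ = Num.min 1 m); last first.
  by apply/max_idPr; rewrite le_min (ltW m1) andbT; lra.
have := @two_piece_distortion_right R a b (Num.min 1 m).
(* The condition on the cut is redundant here: the midpoint of [11/32] and [25/32] is [9/16], so the
   best free cut is compatible with the midpoint constraint. *)
rewrite (_ : [&& _, _ & _] = (a == 11 / 32) && (b == 25 / 32)).
  by apply; rewrite le_min ge_min lexx (ltW m1) !andbT; lra.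
apply/idP/idP => [/andP[]//|/andP[/eqP aE /eqP bE]].
have -> : m = 9 / 16 by rewrite /m aE bE; field.
by rewrite aE bE !eqxx !andbT; apply/eqP/min_idPr; lra.
Qed.

Lemma distortion_fset0 (R : realType) (P : probability (measurableTypeR R) R) :
  distortion P fset0 = +oo%E.
Proof.
rewrite /distortion; under eq_integral do rewrite big_seq_fset0.
by rewrite integral_cst//= probability_setT mule1.
Qed.

(* Singletons are the case a = b. *)
Lemma fset_card_le2 (R : realType) (alpha : {fset R}) : (#|` alpha| <= 2)%N ->
  alpha = fset0 \/ exists a b, a <= b /\ alpha = [fset a; b].
Proof.
have [->|[x xA]] := fset_0Vmem alpha; first by left.
rewrite (cardfsD1 x) xA add1n ltnS leq_eqVlt => xA1; right.
have {xA1} [y ->] : exists y, alpha = [fset x; y].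
  case/predU1P: xA1 => [/eqP/cardfs1P[y E]|].
    by exists y; rewrite -(fsetD1K xA) E.
  rewrite ltnS leqn0 cardfs_eq0 => /eqP E.
  by exists x; rewrite -(fsetD1K xA) E fsetU0 fsetUid.
have [xy|/ltW yx] := leP x y; first by exists x, y.
by exists y, x; rewrite fsetUC.
Qed.

Lemma distortion_fset2 (R : realType) (P : probability (measurableTypeR R) R)
    (a b : R) :
  has_density P (@two_step_pdf R) -> a <= b ->
  distortion P [fset a; b] = (distortion2 a b)%:E.
Proof.
move=> hP ab; rewrite -(integral_min_two_step hP ab) /distortion.
apply: eq_integral => x _.
have [<-|nab] := eqVneq a b; first by rewrite fsetUid big_seq_fset1 minxx.
by rewrite big_fsetU1 ?inE// big_seq_fset1.
Qed.

Theorem proposition4p3 (R : realType) (P : probability (measurableTypeR R) R)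
    (hP : has_density P (@two_step_pdf R)) :
  [/\ optimal_set P 2 [fset (11 / 32 : R); (25 / 32 : R)]%fset,
      (forall alpha : {fset R}, optimal_set P 2 alpha ->
         alpha = [fset (11 / 32 : R); (25 / 32 : R)]%fset) &
      quantization_error P 2 = (317 / 15360)%:E].
Proof.
have card2 : (#|` [fset (11 / 32 : R); (25 / 32 : R)]%fset| <= 2)%N.
  by rewrite cardfs2; case: (_ != _).
have opt : distortion P [fset 11 / 32; 25 / 32] = (317 / 15360)%:E.
  rewrite distortion_fset2//; last by lra.
  by congr EFin; apply/esym/eqP; rewrite (distortion2_leif _ _) !eqxx.
have qE : quantization_error P 2 = (317 / 15360)%:E.
  apply/eqP; rewrite eq_le; apply/andP; split.
    by rewrite -opt; apply: ereal_inf_lbound; exists [fset 11 / 32; 25 / 32].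
  (* Every competitor is either empty, with distortion [+oo], or an ordered pair covered by
     [distortion2_leif]. *)
  apply: le_ereal_inf_tmp => _ [alpha /= /fset_card_le2 alpha2 <-].
  case: alpha2 => [->|[a [b [ab ->]]]]; first by rewrite distortion_fset0 leey.
  by rewrite distortion_fset2// lee_fin (distortion2_leif _ _).
split=> //; first by split=> //; rewrite qE.
move=> alpha []; rewrite qE => /fset_card_le2[->|[a [b [ab ->]]]].
  by rewrite distortion_fset0.
(* Uniqueness is the equality case of [distortion2_leif]. *)
rewrite distortion_fset2// => -[/esym/eqP].
by rewrite (distortion2_leif _ _) => /andP[/eqP -> /eqP ->].
Qed.
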